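(* Let $B$ be a simple graph. If $B$ has a full $B$-queue, then $\operatorname{cfan}(B)\leq 0$.
   Context: For a graph $J$ (here simple), $\mu_J(x,y)$ is the number of edges of $J$ joining $x$ and $y$; $d_J(v)$ is the degree of $v$; $N_J(x)$ is the neighbourhood of $x$. For a graph $H$, a subgraph $K\subseteq H$ and an ordered pair $(x,y)$ with $xy\in E(K)$, $\operatorname{cdeg}_{H,K}(x,y)$ is the smallest nonnegative integer $l$ such that for all $Z\subseteq N_K(x)$ with $y\in Z$, $\sum_{z\in Z}(d_K(z)-d_H(z)+\mu_K(x,z)-l)\leq 1$; $\operatorname{cfan}(H)=\max_{K\subseteq H,\,E(K)\neq\emptyset}\min\{\operatorname{cdeg}_{H,K}(x,y): xy\in E(K)\}$, with $\operatorname{cfan}(H)=0$ if $H$ is edgeless. A $B$-queue of a simple graph $B$ is a sequence of vertices $(u_1,\ldots,u_q)$ together with vertex subsets $(S_0,\ldots,S_q)$ such that $S_0=\emptyset$ and for all $i\in\{1,\ldots,q\}$: $S_i=N_B(u_i)\cup\{u_i\}\cup S_{i-1}$; $1\leq|S_i\setminus S_{i-1}|\leq 2$; $u_i\notin\{u_1,\ldots,u_{i-1}\}$; and $|S_i\setminus(S_{i-1}\cup\{u_i\})|\leq 1$. It is full if $S_q=V(B)$. *)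

(* Defs.v *)
From HB Require Import structures.
From mathcomp Require Import all_boot all_order all_algebra.
Set Implicit Arguments.
Unset Strict Implicit.
Unset Printing Implicit Defensive.
Import Order.TTheory GRing.Theory Num.Theory.
Local Open Scope ring_scope.

(* Finite simple graphs whose vertices are drawn from an ambient finite type
   [T].  The vertex set is explicit, so that a graph and its subgraphs live in
   the same finite type [sgraph T]. *)
Definition sgraph_axiom (T : finType) (p : {set T} * {set {set T}}) : bool :=
  [forall e in p.2, (e \subset p.1) && (#|e| == 2)%N].

Record sgraph (T : finType) := SGraph {
  sgraph_val :> {set T} * {set {set T}};
  _ : sgraph_axiom sgraph_val }.

HB.instance Definition _ (T : finType) := [isSub for @sgraph_val T].
HB.instance Definition _ (T : finType) := [Finite of sgraph T by <:].

Definition verts (T : finType) (J : sgraph T) : {set T} := (sgraph_val J).1.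
Definition edges (T : finType) (J : sgraph T) : {set {set T}} :=
  (sgraph_val J).2.

Definition subgraph (T : finType) (K H : sgraph T) : bool :=
  (verts K \subset verts H) && (edges K \subset edges H).

Definition adj (T : finType) (J : sgraph T) (x y : T) : bool :=
  [set x; y] \in edges J.

Definition mu (T : finType) (J : sgraph T) (x y : T) : nat :=
  #|[set e in edges J | e == [set x; y]]|.

Definition deg (T : finType) (J : sgraph T) (v : T) : nat :=
  #|[set e in edges J | v \in e]|.

Definition nbhd (T : finType) (J : sgraph T) (x : T) : {set T} :=
  [set y | adj J x y].

Definition cdeg_bound (T : finType) (H K : sgraph T) (x y : T) (l : nat)
    : bool :=
  [forall Z : {set T}, (Z \subset nbhd K x) && (y \in Z) ==>
     (\sum_(z in Z) ((deg K z)%:Z - (deg H z)%:Z + (mu K x z)%:Z - l%:Z)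
        <= 1 :> int)].

Lemma cdeg_bound_ex (T : finType) (H K : sgraph T) (x y : T) :
  exists l, cdeg_bound H K x y l.
Proof.
exists (\max_z (deg K z + mu K x z))%N; apply/forallP => Z.
apply/implyP => _; apply: (@le_trans _ _ 0) => //; apply: sumr_le0 => z _.
rewrite subr_le0 addrAC lerBlDr -PoszD lez_nat.
by apply: leq_trans (leq_addr _ _); rewrite (leq_bigmax z).
Qed.

(* Only meaningful when [subgraph K H] and [adj K x y]. *)
Definition cdeg (T : finType) (H K : sgraph T) (x y : T) : nat :=
  ex_minn (cdeg_bound_ex H K x y).

(* Least element of a nonempty sequence; the default of the iterated [minn] is
   itself an element of the sequence, hence does not affect the result. *)
Definition seq_min (s : seq nat) : nat := \big[minn/head 0%N s]_(l <- s) l.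

Lemma seq_min_le (s : seq nat) (m : nat) : m \in s -> (seq_min s <= m)%N.
Proof.
rewrite /seq_min; move: (head _ _) => d; elim: s => // a s IHs.
rewrite inE big_cons geq_min => /predU1P[->|/IHs->]; rewrite ?leqnn //.
by rewrite orbT.
Qed.

Lemma seq_min_mem (s : seq nat) : s != [::] -> seq_min s \in s.
Proof.
case: s => // a s _; rewrite /seq_min /= big_seq.
elim/big_ind: _ => [|m n ms ns|//]; first exact: mem_head.
by rewrite /minn; case: ifP.
Qed.

(* All ordered pairs [(x, y)] with [xy] an edge of [K]: each edge of [K] occurs
   in both orientations. *)
Definition min_cdeg (T : finType) (H K : sgraph T) : nat :=
  seq_min [seq cdeg H K p.1 p.2 | p : T * T in [pred p | adj K p.1 p.2]].

(* The maximum over an empty range is [0], so [cfan H = 0] if [H] has no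
   edge. *)
Definition cfan (T : finType) (H : sgraph T) : nat :=
  (\max_(K : sgraph T | subgraph K H && (edges K != set0)) min_cdeg H K)%N.

(* The vertices [u_1, ..., u_q] are indexed from [0] by ['I_q]: for [i : 'I_q],
   [u i] is [u_(i+1)], [S (lift ord0 i)] is [S_(i+1)] and
   [S (widen_ord (leqnSn q) i)] is [S_i]. *)
Record is_queue (T : finType) (B : sgraph T) (q : nat)
    (u : 'I_q -> T) (S : 'I_q.+1 -> {set T}) : Prop := IsQueue {
  queue_vert : forall i, u i \in verts B;
  queue_sub : forall i, S i \subset verts B;
  queue_S0 : S ord0 = set0;
  queue_step : forall i : 'I_q,
    S (lift ord0 i) =
      nbhd B (u i) :|: [set u i] :|: S (widen_ord (leqnSn q) i);
  queue_new : forall i : 'I_q,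
    (1 <= #|S (lift ord0 i) :\: S (widen_ord (leqnSn q) i)| <= 2)%N;
  queue_neq : forall i : 'I_q, u i \notin [set u j | j : 'I_q & (j < i)%N];
  queue_new1 : forall i : 'I_q,
    (#|S (lift ord0 i) :\: (S (widen_ord (leqnSn q) i) :|: [set u i])| <= 1)%N
}.

Definition is_full_queue (T : finType) (B : sgraph T) (q : nat)
    (u : 'I_q -> T) (S : 'I_q.+1 -> {set T}) : Prop :=
  is_queue B u S /\ S ord_max = verts B.

(* Main.v *)
(* Given a subgraph K with an edge, let x be the first queue vertex incident to
   an edge of K (any non-isolated vertex of K if there is none).  A neighbour z
   of x in K that was already covered by an earlier queue vertex u_j loses the
   edge z u_j in K, so d_K(z) < d_B(z).  At most one neighbour of x is newly
   covered, hence at most one neighbour of x keeps its full degree; taking it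
   for y (any neighbour if there is none) gives cdeg(x, y) = 0, since y
   contributes at most 1 to the sum and every other z at most 0. *)
Require Import Defs.
From HB Require Import structures.
From mathcomp Require Import all_boot all_order all_algebra.
From mathcomp Require Import zify.

Lemma adjC (T : finType) (J : sgraph T) (x y : T) : adj J x y = adj J y x.
Proof. by rewrite /adj setUC. Qed.

Lemma adj_irrefl (T : finType) (J : sgraph T) (x : T) : ~~ adj J x x.
Proof.
rewrite /adj /edges; case: J => p /= /forall_inP axp.
by apply/negP => /axp/andP[_]; rewrite setUid cards1.
Qed.

Lemma mu_le1 (T : finType) (J : sgraph T) (x y : T) : (mu J x y <= 1)%N.
Proof.
rewrite /mu -(cards1 [set x; y]); apply: subset_leq_card.
by apply/subsetP => e; rewrite !inE => /andP[].
Qed.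

Lemma adj_in_verts (T : finType) (J : sgraph T) (x y : T) :
  adj J x y -> x \in verts J.
Proof.
rewrite /adj /edges /verts; case: J => p /= /forall_inP axp /axp/andP[+ _].
by move/subsetP; apply; rewrite set21.
Qed.

Lemma edge_adj (T : finType) (J : sgraph T) :
  edges J != set0 -> exists x y, adj J x y.
Proof.
case/set0Pn => e eJ; suff /cards2P[x [y [_ e_xy]]] : #|e| == 2%N.
  by exists x, y; rewrite /adj -e_xy.
by move: eJ; rewrite /edges; case: J => p /= /forall_inP axp /axp/andP[].
Qed.

Section Subgraph.
Variables (T : finType) (H K : sgraph T).
Hypothesis sKH : subgraph K H.

Lemma subgraph_adj (x y : T) : adj K x y -> adj H x y.
Proof. by case/andP: sKH => _ /subsetP; apply. Qed.

Lemma subgraph_deg (v : T) : (deg K v <= deg H v)%N.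
Proof.
apply/subset_leq_card/subsetP => e; rewrite !inE => /andP[eK ->].
by case/andP: sKH => _ /subsetP->.
Qed.

Lemma subgraph_deg_lt (v w : T) :
  adj H v w -> ~~ adj K v w -> (deg K v < deg H v)%N.
Proof.
move=> vwH vwNK; apply/proper_card/properP; split.
  apply/subsetP => e; rewrite !inE => /andP[eK ->].
  by case/andP: sKH => _ /subsetP->.
exists [set v; w]; rewrite !inE eqxx /= andbT //.
Qed.

(** The value [l = 0] already satisfies the bound: the term of [y] is at most [mu K x y], hence at
    most 1, and for any other [z] the degree drop cancels [mu K x z]. *)
Lemma cdeg_eq0 (x y : T) :
  (forall z, adj K x z -> z != y -> (deg K z < deg H z)%N) ->
  cdeg H K x y = 0%N.
Proof.
move=> lt_deg; rewrite /cdeg; case: ex_minnP => m _ /(_ 0%N) min_m.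
apply/eqP; rewrite -leqn0; apply: min_m.
apply/forallP => Z; apply/implyP => /andP[/subsetP sZ yZ].
rewrite (bigD1 y) //= -[leRHS]GRing.addr0 Num.Theory.lerD //.
  by have := subgraph_deg y; have := mu_le1 _ K x y; lia.
apply: Num.Theory.sumr_le0 => z /andP[/sZ + zNy]; rewrite inE => xzK.
by have := lt_deg z xzK zNy; have := mu_le1 _ K x z; lia.
Qed.

(** [A] holds the vertices that may keep their full degree. A neighbour of [x] in [A], or any
    neighbour if [A] contains none, serves as [y] in [cdeg_eq0]. *)
Lemma min_cdeg_eq0 (x : T) (A : {set T}) :
  nbhd K x != set0 -> (#|A| <= 1)%N ->
  (forall z, adj K x z -> z \notin A -> (deg K z < deg H z)%N) ->
  min_cdeg H K = 0%N.
Proof.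
move=> /set0Pn[y0 y0K] A1 lt_deg.
suff [y xyK cdeg0] : exists2 y, adj K x y & cdeg H K x y = 0%N.
  apply/eqP; rewrite -leqn0 /min_cdeg; apply: seq_min_le; rewrite -cdeg0.
  by apply/imageP; exists (x, y).
have [y /andP[xyK yA]|noA] := pickP (fun y => adj K x y && (y \in A)).
  exists y => //; apply: cdeg_eq0 => z xzK zNy; apply: lt_deg => //.
  apply: contra zNy => zA; apply/eqP.
  by move/card_le1_eqP: A1; apply.
exists y0; first by rewrite inE in y0K.
apply: cdeg_eq0 => z xzK _; apply: lt_deg => //.
by have := noA z; rewrite xzK /= => ->.
Qed.

End Subgraph.

(** Unfolding [queue_step] down to the empty [S ord0] shows that [S i] is the union of the closed
    neighbourhoods of the [u j] with [j < i]. *)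
Lemma queue_covered (T : finType) (B : sgraph T) (q : nat) (u : 'I_q -> T)
    (S : 'I_q.+1 -> {set T}) (i : 'I_q.+1) (v : T) :
  is_queue B u S -> v \in S i ->
  exists j : 'I_q, (j < i)%N /\ (v = u j \/ adj B v (u j)).
Proof.
move=> quS; case: i => m; elim: m => [|m IHm] ltm vS.
  suff : v \in S ord0 by rewrite (queue_S0 quS) inE.
  by rewrite (_ : ord0 = Ordinal ltm) //; apply: val_inj.
pose i : 'I_q := Ordinal (ltm : (m < q)%N).
have Ei : Ordinal ltm = lift ord0 i by apply: val_inj.
move: vS; rewrite Ei (queue_step quS) !inE => /orP[/orP[uv|/eqP->]|vS].
- by exists i; split=> //; right; rewrite adjC.
- by exists i; split=> //; left.
have [|j [ltj jv]] := IHm (ltnW ltm).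
  by rewrite (_ : Ordinal _ = widen_ord (leqnSn q) i) //; apply: val_inj.
by exists j; split=> //; apply: ltnW.
Qed.

Theorem theorem3p6 (T : finType) (B : sgraph T) :
  (exists (q : nat) (u : 'I_q -> T) (S : 'I_q.+1 -> {set T}),
     is_full_queue B u S) ->
  (cfan B <= 0)%N.
Proof.
case=> q [u [S [quS fullS]]].
apply/bigmax_leqP => K /andP[sKB K0]; rewrite leqn0; apply/eqP.
have covered_lt (i : 'I_q.+1) x z :
    (forall j : 'I_q, (j < i)%N -> nbhd K (u j) = set0) ->
    adj K x z -> z \in S i -> (deg K z < deg B z)%N.
  (* The case [z = u j] is impossible, as [u j] is isolated in [K]; otherwise the edge of [B] from
     [z] to [u j] is missing in [K]. *)
  move=> K0u xzK /(queue_covered _ _ _ _ _ _ _ quS)[j [/K0u Kj [zu|zu]]].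
    by have := in_set0 x; rewrite -Kj inE -zu adjC xzK.
  apply: (subgraph_deg_lt _ _ _ sKB _ _ zu).
  by have := in_set0 z; rewrite -Kj inE adjC => ->.
have [i0 Ki0|Ku] := pickP (fun i => nbhd K (u i) != set0).
  have [i Ki min_i] := @arg_minnP _ i0 (fun i => nbhd K (u i) != set0) val Ki0.
  (* Here [A] is the set of vertices other than [u i] that [u i] newly covers. *)
  apply: (min_cdeg_eq0 _ _ _ sKB _ _ Ki (queue_new1 quS i)) => z uzK.
  have zS : z \in S (lift ord0 i).
    by rewrite (queue_step quS) !inE (subgraph_adj _ _ _ sKB).
  rewrite inE zS andbT negbK !inE => /orP[|/eqP zu]; last first.
    by move: uzK; rewrite zu (negbTE (adj_irrefl _ _ _)).
  apply: covered_lt uzK => j ltji; apply/eqP; apply: contraLR ltji => Kj.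
  by rewrite -leqNgt min_i.
have [x [y xyK]] := edge_adj _ _ K0.
(* All queue vertices are isolated in [K], so by fullness every neighbour of [x] loses degree and
   [A] can be empty. *)
apply: (min_cdeg_eq0 _ _ _ sKB x set0); rewrite ?cards0 //.
  by apply/set0Pn; exists y; rewrite inE.
move=> z xzK _; apply: (covered_lt ord_max x) => //.
  by move=> j _; apply/eqP; have := Ku j; move/negbFE.
rewrite fullS; apply: (adj_in_verts _ _ _ x); rewrite adjC.
exact: subgraph_adj xzK.
Qed.
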